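(* Let $\varphi\equiv\bigwedge_{i=1}^t\varphi_i$ be an $X$-positive basic conjunction of spread $m$ and range $r$ over a graph language $L\cup\{X\}$, and let $C,M\notin L\cup\{X\}$ be distinct unary predicate symbols; let $m_i$ be the spread of $\varphi_i$. Let $\varepsilon_1,\varepsilon_2>0$ be reals. Let $G$ be an $L$-interpretation and $\lambda$ a layering of $\overline G$. For an interval $I$ of consecutive integers let $G_I$ denote the $(L\cup\{C,M\})$-interpretation $G[\lambda^{-1}(I)],\ C:=\lambda^{-1}(M_{2r}(I)),\ M:=\lambda^{-1}(M_r(I))$. For each such $I$ and each $t$-tuple $q$ of non-negative integers, let $A_{I,q}$ be undefined if $G_I,X:=V(\overline{G_I})\not\models\varphi^{(q)}$, and otherwise let $A_{I,q}$ be any set with $G_I,X:=A_{I,q}\models\varphi^{(q)}$ and $|A_{I,q}|\le(1+\varepsilon_1)\gamma_{\varphi^{(q)}}(G_I)$. Let $\ell>2r(1+\max(2/\varepsilon_2,6mt))$ be an integer. For an $(\ell,r)$-cover $R$ of integers and a $t$-tuple $p=(p_1,\dots,p_t)$ where each $p_i$ is an $m_i$-plan for $R$, write $p(I)=(p_1(I),\dots,p_t(I))$, let $A_{R,p}=\bigcup_{I\in R}A_{I,p(I)}$ (undefined if some $A_{I,p(I)}$ is undefined) and $a_{R,p}=\sum_{I\in R}|A_{I,p(I)}|$. Let $A=A_{R,p}$ for a choice of $(R,p)$ minimizing $a_{R,p}$ among those for which $A_{R,p}$ is defined ($A$ undefined if there is no such choice). Then either $G,X:=V(\overline G)\not\models\varphi$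 and $A$ is undefined, or $G,X:=A\models\varphi$ and $|A|\le(1+\varepsilon_1)(1+\varepsilon_2)\gamma_\varphi(G)$.
   Context: A graph language $L$ consists of a binary predicate symbol $e$ and a finite set of unary predicate symbols. An $L$-interpretation $G$ consists of a graph $\overline G$ and a set $S_C\subseteq V(\overline G)$ for each unary $C\in L$; $e$ is interpreted as adjacency in $\overline G$. For $S\subseteq V(\overline G)$, $G[S]$ is the interpretation on $\overline G[S]$ with each unary predicate restricted to $S$; ''$H, C:=A, M:=B$'' denotes the expansion of $H$ with new unary predicates $C,M$ interpreted as $A,B$, and $H,X:=A\models\theta$ means $\theta$ holds when $X$ is interpreted as $A$. A formula is $X$-positive if every occurrence of $X$ is within the scope of an even number of negations. For an $X$-positive sentence $\theta$ and interpretation $H$, $\gamma_\theta(H)$ is the minimum size of $A\subseteq V(\overline H)$ with $H,X:=A\models\theta$. A layering of a graph is a function $\lambda:V\to\mathbb Z$ with $|\lambda(u)-\lambda(v)|\le1$ on edges. $d(x,y)\le r$ abbreviates $(\exists z_0,\dots,z_r)\,z_0=x\land z_r=y\land\bigwedge_{i=1}^r(z_{i-1}=z_i\lor e(z_{i-1},z_i))$. An $r$-local formula is a formula $\psi$ with one free variable $x$ in which all quantifications are of the form $(\exists y: d(x,y)\le r)$ or $(\forall y: d(x,y)\le r)$. A basic existential sentence is one of the form $(\exists x_1,\dots,x_m)\bigwedge_{1\le i<j\le m}d(x_i,x_j)>2r\land\bigwedge_{i=1}^m\psi(x_i)$, and a basic universal sentence is one of the form $(\forall x_1,\dots,x_{m+1})\bigl(\bigwedge_{1\le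 i<j\le m+1}d(x_i,x_j)>2r\bigr)\Rightarrow\bigvee_{i=1}^{m+1}\psi(x_i)$, where in both cases $\psi$ is $r$-local; $m$ is the spread, $r$ the range and $\psi$ the core. A basic conjunction is a conjunction of basic existential and basic universal sentences; its spread and range are the maxima of those of its conjuncts. For a basic existential/universal $\varphi$ and an integer $k\ge0$, the $(C,M,k)$-variant $\varphi^{(k)}$ is $(\exists x_1,\dots,x_k)\bigwedge_{1\le i<j\le k}d(x_i,x_j)>2r\land\bigwedge_{i=1}^k(C(x_i)\land\psi(x_i))$ if $\varphi$ is basic existential, and $(\forall x_1,\dots,x_{k+1})\bigl(\bigwedge_{i=1}^{k+1}M(x_i)\land\bigwedge_{1\le i<j\le k+1}d(x_i,x_j)>2r\bigr)\Rightarrow\bigvee_{i=1}^{k+1}\psi(x_i)$ if basic universal. For a basic conjunction $\varphi\equiv\bigwedge_{i=1}^t\varphi_i$ and a $t$-tuple $q=(q_1,\dots,q_t)$ of non-negative integers, $\varphi^{(q)}\equiv\bigwedge_{i=1}^t\varphi_i^{(q_i)}$. For integers $\ell\ge 2r+1$ and $n$, the set of all intervals $\{i,i+1,\dots,i+\ell-1\}$ with $i\equiv n\pmod{\ell-2r}$ is an $(\ell,r)$-cover of integers (there are exactly $\ell-2r$ distinct ones). For an integer $d\ge0$ and $I=\{i,\dots,i+\ell-1\}$ in a cover, $M_d(I)=\{i+d,\dots,i+\ell-d-1\}$. An $m$-plan for a cover $R$ is a function $p:R\to\mathbb Z_{\ge0}$ with $\sum_{I\in R}p(I)=m$. *)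

(* Defs.v *)
From HB Require Import structures.
From mathcomp Require Import all_boot all_order all_algebra.
Set Implicit Arguments. Unset Strict Implicit. Unset Printing Implicit Defensive.
Import Order.TTheory GRing.Theory Num.Theory.

(* Predicate symbols and variables are natural numbers.  The graph of an
   interpretation is the subgraph induced on its vertex set [ivs] by a fixed
   ambient (symmetric, irreflexive) adjacency relation [e] on a finite type T. *)

Record interp (T : finType) := Interp { ivs : {set T}; ipr : nat -> {set T} }.

Inductive form :=
| FTrue | FFalse
| FEq of nat & nat
| FEdge of nat & nat
| FPred of nat & nat
| FDist of nat & nat & nat      (* FDist k i j == d(x_i,x_j) <= k (the abbreviation) *)
| FNot of form
| FAnd of form & form
| FOr of form & form
| FImp of form & form
| FEx of nat & form
| FAll of nat & form.

Section Logic.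
Variables (T : finType) (e : rel T).

Definition upd (env : nat -> T) (v : nat) (a : T) : nat -> T :=
  fun w => if w == v then a else env w.

(* d(x,y) <= k : the existential abbreviation of the paper, unfolded *)
Definition dle (H : interp T) (k : nat) (x y : T) : bool :=
  [exists z : {ffun 'I_k.+1 -> T},
    [&& [forall i, z i \in ivs H], z ord0 == x, z ord_max == y &
        [forall i : 'I_k, (z (widen_ord (leqnSn k) i) == z (lift ord0 i))
                          || e (z (widen_ord (leqnSn k) i)) (z (lift ord0 i))]]].

Fixpoint sat (H : interp T) (env : nat -> T) (f : form) : bool :=
  match f with
  | FTrue => true
  | FFalse => false
  | FEq i j => env i == env j
  | FEdge i j => e (env i) (env j)
  | FPred c i => env i \in ipr H c
  | FDist k i j => dle H k (env i) (env j)
  | FNot g => ~~ sat H env g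
  | FAnd g h => sat H env g && sat H env h
  | FOr g h => sat H env g || sat H env h
  | FImp g h => sat H env g ==> sat H env h
  | FEx v g => [exists a in ivs H, sat H (upd env v a) g]
  | FAll v g => [forall a in ivs H, sat H (upd env v a) g]
  end.

Definition setPr (H : interp T) (c : nat) (A : {set T}) : interp T :=
  Interp (ivs H) (fun d => if d == c then A else ipr H d).

Definition induce (H : interp T) (S : {set T}) : interp T :=
  Interp (ivs H :&: S) (fun d => ipr H d :&: (ivs H :&: S)).

End Logic.

Fixpoint preds (f : form) : seq nat :=
  match f with
  | FPred c _ => [:: c]
  | FNot g => preds g
  | FAnd g h | FOr g h | FImp g h => preds g ++ preds h
  | FEx _ g | FAll _ g => preds g
  | _ => [::]
  end.

(* polarity: b = true means an even number of enclosing negations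
   (the antecedent of an implication counts as negated) *)
Fixpoint xmono (X : nat) (b : bool) (f : form) : bool :=
  match f with
  | FPred c _ => (c != X) || b
  | FNot g => xmono X (~~ b) g
  | FAnd g h | FOr g h => xmono X b g && xmono X b h
  | FImp g h => xmono X (~~ b) g && xmono X b h
  | FEx _ g | FAll _ g => xmono X b g
  | _ => true
  end.

Definition xpositive (X : nat) (f : form) : bool := xmono X true f.

(* [local r x bound f]: every quantification in f is of the form
   (exists y : d(x,y) <= r) or (forall y : d(x,y) <= r), and every variable
   occurring free is x (variables in [bound] are bound by enclosing quantifiers). *)
Fixpoint local (r x : nat) (bound : seq nat) (f : form) : bool :=
  match f with
  | FTrue | FFalse => true
  | FEq i j | FEdge i j => (i \in x :: bound) && (j \in x :: bound)
  | FPred _ i => i \in x :: bound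
  | FDist _ _ _ => false
  | FNot g => local r x bound g
  | FAnd g h | FOr g h | FImp g h => local r x bound g && local r x bound h
  | FEx y (FAnd (FDist k i j) g) =>
      [&& k == r, i == x, j == y, y != x & local r x (y :: bound) g]
  | FAll y (FImp (FDist k i j) g) =>
      [&& k == r, i == x, j == y, y != x & local r x (y :: bound) g]
  | FEx _ _ | FAll _ _ => false
  end.

Definition rlocal (r : nat) (psi : form) : bool := local r 0 [::] psi.

(* A basic sentence: existential (bexist = true) or universal, with spread m,
   range r and core psi (an r-local formula in variable 0). *)
Record basic := Basic { bexist : bool; bspread : nat; brange : nat; bcore : form }.

Section Basic.
Variables (T : finType) (e : rel T).

Definition far (H : interp T) (r n : nat) (xs : {ffun 'I_n -> T}) : bool :=
  [forall i : 'I_n, forall j : 'I_n, (i < j) ==> ~~ dle e H (2 * r) (xs i) (xs j)].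

Definition inV (H : interp T) (n : nat) (xs : {ffun 'I_n -> T}) : bool :=
  [forall i, xs i \in ivs H].

Definition core_at (H : interp T) (psi : form) (v : T) : bool :=
  sat e H (fun _ => v) psi.

Definition sat_basic (H : interp T) (b : basic) : bool :=
  if bexist b then
    [exists xs : {ffun 'I_(bspread b) -> T},
      [&& inV H xs, far H (brange b) xs & [forall i, core_at H (bcore b) (xs i)]]]
  else
    [forall xs : {ffun 'I_(bspread b).+1 -> T},
      (inV H xs && far H (brange b) xs) ==> [exists i, core_at H (bcore b) (xs i)]].

Definition sat_conj (H : interp T) (phi : seq basic) : bool := all (sat_basic H) phi.

Definition sat_var (C M : nat) (H : interp T) (b : basic) (k : nat) : bool :=
  if bexist b then
    [exists xs : {ffun 'I_k -> T},
      [&& inV H xs, far H (brange b) xs &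
          [forall i, (xs i \in ipr H C) && core_at H (bcore b) (xs i)]]]
  else
    [forall xs : {ffun 'I_k.+1 -> T},
      [&& inV H xs, [forall i, xs i \in ipr H M] & far H (brange b) xs]
        ==> [exists i, core_at H (bcore b) (xs i)]].

(* phi^(q); q must have size (size phi) *)
Definition sat_varc (C M : nat) (H : interp T) (phi : seq basic) (q : seq nat) : bool :=
  all (fun bq => sat_var C M H bq.1 bq.2) (zip phi q).

(* gamma_theta(H): minimum |A|, A subset of V(H), with H, X := A |= theta
   (the default #|T| is only reached when no such A exists). *)
Definition gamma (X : nat) (H : interp T) (P : interp T -> bool) : nat :=
  \big[minn/#|T|]_(A : {set T} | (A \subset ivs H) && P (setPr H X A)) #|A|.

Definition layering (G : interp T) (lam : T -> int) : Prop :=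
  forall u v, u \in ivs G -> v \in ivs G -> e u v -> (`|lam u - lam v| <= 1)%R.

Definition layer (lam : T -> int) (a b : int) : {set T} :=
  [set v | (a <= lam v)%R && (lam v <= b)%R].

Definition GI (G : interp T) (lam : T -> int) (r C M : nat) (a b : int) : interp T :=
  let H := induce G (layer lam a b) in
  let H1 := setPr H C (ivs H :&: layer lam (a + (2 * r)%:Z) (b - (2 * r)%:Z)) in
  setPr H1 M (ivs H :&: layer lam (a + r%:Z) (b - r%:Z)).

End Basic.

Definition Aspec (R : realFieldType) (T : finType) (e : rel T) (G : interp T)
  (lam : T -> int) (r X C M : nat) (phi : seq basic) (eps1 : R)
  (a b : int) (q : seq nat) (Aq : option {set T}) : Prop :=
  let H := GI G lam r C M a b in
  if sat_varc e C M (setPr H X (ivs H)) phi q then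
    exists A, [/\ Aq = Some A, A \subset ivs H, sat_varc e C M (setPr H X A) phi q &
      (#|A|%:R <= (1 + eps1) * (gamma X H (fun H' => sat_varc e C M H' phi q))%:R)%R]
  else Aq = None.

(* m-plan for a cover, indexed by j : int (interval number j of the cover) *)
Definition is_plan (m : nat) (p : int -> nat) : Prop :=
  exists s : seq int, [/\ uniq s, (forall j, j \notin s -> p j = 0) &
                           \sum_(j <- s) p j = m].

(* The cover with offset n: interval number j is {st j, ..., st j + ell - 1}
   with st j = n + j (ell - 2r). *)
Definition cst (ell r : nat) (n j : int) : int := (n + j * (ell%:Z - (2 * r)%:Z))%R.
Definition cen (ell r : nat) (n j : int) : int := (cst ell r n j + ell%:Z - 1)%R.

Definition pI (t : nat) (p : nat -> int -> nat) (j : int) : seq nat :=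
  [seq p i j | i <- iota 0 t].

Section Cover.
Variables (T : finType) (Asel : int -> int -> seq nat -> option {set T})
          (ell r : nat) (phi : seq basic).

Definition AIj (n : int) (p : nat -> int -> nat) (j : int) : option {set T} :=
  Asel (cst ell r n j) (cen ell r n j) (pI (size phi) p j).

Definition valid (n : int) (p : nat -> int -> nat) : Prop :=
  (forall i, i < size phi -> is_plan (bspread (nth (Basic true 0 0 FTrue) phi i)) (p i))
  /\ (forall j, AIj n p j <> None).

Definition Aunion (n : int) (p : nat -> int -> nat) (U : {set T}) : Prop :=
  forall v, v \in U <-> exists j A, AIj n p j = Some A /\ v \in A.

(* a = a_{R,p} = sum over all j of |A_{I_j,p(I_j)}| (finitely supported) *)
Definition asum (n : int) (p : nat -> int -> nat) (a : nat) : Prop :=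
  exists s : seq int, [/\ uniq s,
    (forall j, j \notin s -> forall A, AIj n p j = Some A -> A = set0) &
    a = \sum_(j <- s) #|odflt set0 (AIj n p j)|].

End Cover.

(* Main.v *)
Require Import Defs.
From HB Require Import structures.
From mathcomp Require Import all_boot all_order all_algebra.
From mathcomp Require Import zify lra.
Import Order.TTheory GRing.Theory Num.Theory.

(** Write [D = ell - 2r]. The sets [M_r(I)] of a cover partition the integers
    into blocks of [D] layers, and the cores [M_{2r}(I)] are separated by seams
    of [2r] layers. Distances up to [2r] between vertices of [M_r(I)], and
    [r]-local formulas there, have the same value in [G_I] and in [G].

    Soundness. Witnesses found in different cores are at distance more than
    [2r], so the existential variants add up; [m + 1] far vertices violating a
    universal core would overload some block, so the universal ones do too.

    Near-optimality. Take an optimal [A]. Every conjunct determines a set [S] of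
    at most [m] vertices: its witnesses, or a maximum far set of vertices that
    violate the core, in which case every violating vertex is within [2r] of
    [S]. If no seam comes within [2r] of the layers of [S], then counting [S] in
    each block gives a plan realised by [A]. At most [6r] of the [D] offsets
    fail for each vertex of [S], hence at most half of them in total, and the
    total overlap of the intervals averaged over all offsets is [2r|A|/D]; so
    some good offset has overlap at most [4r|A|/D <= eps2 |A|]. *)

Set Implicit Arguments.
Unset Strict Implicit.
Unset Printing Implicit Defensive.

(** * Walks, distances and layers *)

Section Distance.
Variables (T : finType) (e : rel T).
Implicit Types (H : interp T) (lam : T -> int).

Lemma dleP H k x y :
  reflect (exists w : nat -> T,
             [/\ forall i, i <= k -> w i \in ivs H, w 0 = x, w k = y
               & forall i, i < k -> (w i == w i.+1) || e (w i) (w i.+1)])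
          (dle e H k x y).
Proof.
apply: (iffP existsP) => [[z /and4P[/forallP zV /eqP z0 /eqP zk /forallP zS]]|].
  exists (fun i => z (inord i)); split=> [i _ //|||i lt_ik].
  - by rewrite -z0; congr (z _); apply: val_inj; rewrite /= inordK.
  - by rewrite -zk; congr (z _); apply: val_inj; rewrite /= inordK.
  have := zS (Ordinal lt_ik); congr (is_true (_ || _)).
    by congr (z _ == z _); apply: val_inj; rewrite /= inordK // ltnS ltnW.
  by congr (e (z _) (z _)); apply: val_inj; rewrite /= inordK // ltnS ltnW.
move=> [w [wV w0 wk wS]]; exists [ffun i : 'I_k.+1 => w i].
rewrite !ffunE w0 wk !eqxx /=; apply/andP; split; apply/forallP => i.
  by rewrite ffunE wV // -ltnS.
by rewrite !ffunE /= /bump leq0n add1n wS.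
Qed.

Lemma dle_in H k x y : dle e H k x y -> (x \in ivs H) && (y \in ivs H).
Proof. by case/dleP=> w [wV <- <- _]; rewrite !wV. Qed.

Lemma dle_refl H k x : x \in ivs H -> dle e H k x x.
Proof. by move=> xH; apply/dleP; exists (fun=> x); split=> // i _; rewrite eqxx. Qed.

Lemma dle_sym H k x y : symmetric e -> dle e H k x y = dle e H k y x.
Proof.
move=> e_sym; have imp u v : dle e H k u v -> dle e H k v u.
  case/dleP=> w [wV w0 wk wS]; apply/dleP; exists (fun i => w (k - i)).
  rewrite subn0 subnn; split=> // [i _|i lt_ik]; first by rewrite wV ?leq_subr.
  have := wS (k - i.+1); rewrite (_ : (k - i.+1).+1 = k - i); last by lia.
  by rewrite eq_sym e_sym; apply; lia.
by apply/idP/idP; apply: imp.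
Qed.

Lemma walk_lam H lam k (w : nat -> T) :
  layering e H lam -> (forall i, i <= k -> w i \in ivs H) ->
  (forall i, i < k -> (w i == w i.+1) || e (w i) (w i.+1)) ->
  forall d i, i + d <= k -> (`|lam (w i) - lam (w (i + d)%N)| <= d%:Z)%R.
Proof.
move=> layH wV wS; elim=> [|d IHd] i le_k; first by rewrite addn0 subrr normr0.
have step : (`|lam (w (i + d)%N) - lam (w (i + d)%N.+1)| <= 1)%R.
  have /orP[/eqP <-|] := wS (i + d) ltac:(lia); first by rewrite subrr normr0.
  by apply: layH; apply: wV; lia.
by have := IHd i ltac:(lia); rewrite addnS; lia.
Qed.

Lemma dle_lam H lam k x y :
  layering e H lam -> dle e H k x y -> (`|lam x - lam y| <= k%:Z)%R.
Proof.
move=> layH /dleP[w [wV <- <- wS]].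
exact: (walk_lam layH wV wS (d := k) (i := 0) (leqnn k)).
Qed.

Lemma dle_sub H1 H2 k x y :
  ivs H1 \subset ivs H2 -> dle e H1 k x y -> dle e H2 k x y.
Proof.
move=> /subsetP sub12 /dleP[w [wV w0 wk wS]]; apply/dleP; exists w; split=> //.
by move=> i /wV /sub12.
Qed.

(** Each vertex of the walk is within [r] steps of an end lying [r] layers inside the window: of [x]
    if [k <= r], of one of the two ends if [k <= 2 r]. *)
Lemma dle_restrict H1 H2 lam (a b : int) r k x y :
  layering e H1 lam -> ivs H1 :&: layer lam a b \subset ivs H2 ->
  x \in layer lam (a + r%:Z) (b - r%:Z) ->
  (k <= r) || (k <= 2 * r) && (y \in layer lam (a + r%:Z) (b - r%:Z)) ->
  dle e H1 k x y -> dle e H2 k x y.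
Proof.
move=> layH /subsetP sub xl yl /dleP[w [wV w0 wk wS]].
apply/dleP; exists w; split=> // i le_ik; apply: sub; rewrite inE wV //= inE.
move: xl yl; rewrite -w0 -wk !inE.
have := walk_lam layH wV wS (d := i) (i := 0) le_ik.
have := walk_lam layH wV wS (d := k - i) (i := i) ltac:(lia).
rewrite add0n subnKC //; lia.
Qed.

End Distance.

(** * Monotonicity in [X] and locality of formulas *)

Section Semantics.
Variables (T : finType) (e : rel T).
Implicit Types (H : interp T) (f : Defs.form).

Lemma dle_setPr H c A k x y : dle e (setPr H c A) k x y = dle e H k x y.
Proof. by []. Qed.

(** The polarity [b] is general because negations and antecedents reverse the direction of the
    implication. *)
Lemma sat_mono H X (A B : {set T}) f : A \subset B -> forall (b : bool) env,
  xmono X b f ->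
  if b then sat e (setPr H X A) env f -> sat e (setPr H X B) env f
  else sat e (setPr H X B) env f -> sat e (setPr H X A) env f.
Proof.
move=> /subsetP subAB.
elim: f => [||i j|i j|c i|k i j|g IH|g IHg h IHh|g IHg h IHh|g IHg h IHh|v g IH|v g IH]
  b env /=; try by case: b.
- by case: eqP => _; case: b => //= _; apply: subAB.
- by move=> /(IH _ env); case: b => /= imp; apply: contra.
- by case/andP=> /(IHg _ env) + /(IHh _ env); case: b => impg imph /andP[/impg-> /imph->].
- case/andP=> /(IHg _ env) + /(IHh _ env).
  by case: b => impg imph /orP[/impg->|/imph->]; rewrite ?orbT.
- case/andP=> /(IHg _ env) + /(IHh _ env).
  by case: b => /= impg imph /implyP gh; apply/implyP => /impg /gh /imph.
- move=> mono; case: b mono => mono /exists_inP[a aH sa]; apply/exists_inP; exists a => //.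
    by apply: (IH true _ mono).
  by apply: (IH false _ mono).
- move=> mono; case: b mono => mono /forall_inP sa; apply/forall_inP => a aH.
    by apply: (IH true _ mono); apply: sa.
  by apply: (IH false _ mono); apply: sa.
Qed.

Lemma core_at_mono H X (A B : {set T}) f v : A \subset B -> xpositive X f ->
  core_at e (setPr H X A) f v -> core_at e (setPr H X B) f v.
Proof. by move=> subAB; exact: (sat_mono H subAB (b := true) (fun=> v)). Qed.

(** Relativised quantifiers keep every variable inside the [r]-ball around [v], so only distances
    from [v] and the predicates on that ball matter. *)
Lemma sat_local H1 H2 r v :
  (forall y, dle e H1 r v y = dle e H2 r v y) ->
  forall f, (forall c y, c \in preds f -> dle e H1 r v y ->
               (y \in ipr H1 c) = (y \in ipr H2 c)) ->
  forall bound env, local r 0 bound f -> env 0 = v ->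
  (forall i, i \in 0 :: bound -> dle e H1 r v (env i)) ->
  sat e H1 env f = sat e H2 env f.
Proof.
(* The body [g] of a relativised quantifier sits two constructors deep, next to a guard that is not
   itself [local]; the recursion has to reach past the guard directly to [g]. *)
move=> dleE; fix IH 1.
case=> [||i j|i j|c i|k i j|g|g h|g h|g h|y g|y g] predE bound env //= loc env0 ball.
- by apply: predE; rewrite ?mem_head // ball.
- by rewrite (IH g predE bound).
- case/andP: loc => lg lh; rewrite (IH g _ bound) 1?(IH h _ bound) // => c y cp;
    by apply: predE; rewrite /= mem_cat cp ?orbT.
- case/andP: loc => lg lh; rewrite (IH g _ bound) 1?(IH h _ bound) // => c y cp;
    by apply: predE; rewrite /= mem_cat cp ?orbT.
- case/andP: loc => lg lh; rewrite (IH g _ bound) 1?(IH h _ bound) // => c y cp;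
    by apply: predE; rewrite /= mem_cat cp ?orbT.
- case: g predE loc => // -[] // k i j g predE /and5P[/eqP-> /eqP-> /eqP-> ny lg] /=.
  have eqg a : dle e H1 r v a -> sat e H1 (upd env y a) g = sat e H2 (upd env y a) g.
    move=> va; apply: (IH g predE (y :: bound)) => //.
      by rewrite /upd eq_sym (negPf ny).
    move=> i'; rewrite /upd; case: eqP => // ne; rewrite !inE => /or3P[/eqP-> ||].
    + by rewrite ball ?mem_head.
    + by move/eqP.
    + by move=> ib; rewrite ball // inE ib orbT.
  rewrite /upd eq_sym (negPf ny) eqxx env0.
  apply/exists_inP/exists_inP => -[a _ /andP[va sa]]; exists a.
  + by rewrite dleE in va; case/andP: (dle_in va).
  + by rewrite -dleE va -eqg.
  + by rewrite -dleE in va; case/andP: (dle_in va).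
  + by rewrite dleE va eqg // dleE.
- case: g predE loc => // -[] // k i j g predE /and5P[/eqP-> /eqP-> /eqP-> ny lg] /=.
  have eqg a : dle e H1 r v a -> sat e H1 (upd env y a) g = sat e H2 (upd env y a) g.
    move=> va; apply: (IH g predE (y :: bound)) => //.
      by rewrite /upd eq_sym (negPf ny).
    move=> i'; rewrite /upd; case: eqP => // ne; rewrite !inE => /or3P[/eqP-> ||].
    + by rewrite ball ?mem_head.
    + by move/eqP.
    + by move=> ib; rewrite ball // inE ib orbT.
  rewrite /upd eq_sym (negPf ny) eqxx env0.
  apply/forall_inP/forall_inP => sa a _; apply/implyP => va.
  + rewrite -dleE in va; rewrite -eqg //.
    by case/andP: (dle_in va) => _ /sa /implyP; apply.
  + rewrite eqg //; rewrite dleE in va.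
    by case/andP: (dle_in va) => _ /sa /implyP; apply.
Qed.

End Semantics.

(** * Basic sentences in terms of far sets *)

Section FarSets.
Variables (T : finType) (e : rel T) (e_sym : symmetric e).
Implicit Types (H : interp T) (S : {set T}) (b : basic).

Definition farset H k S := {in S &, forall x y, x != y -> ~~ dle e H k x y}.

Lemma farset_sub H k S S' : S' \subset S -> farset H k S -> farset H k S'.
Proof. by move=> /subsetP sub farS x y /sub xS /sub yS; apply: farS. Qed.

(** A vertex is at distance at most [2 r] from itself, so far tuples are injective and carry the
    same data as far sets of cardinality [n]. *)
Lemma far_existsP H r n (Q : pred T) :
  reflect (exists S, [/\ S \subset ivs H, #|S| = n, farset H (2 * r) S
                       & {in S, forall x, Q x}])
          [exists xs : {ffun 'I_n -> T},
             [&& inV H xs, far e H r xs & [forall i, Q (xs i)]]].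
Proof.
apply: (iffP existsP) => [[xs /and3P[/forallP xsV /forallP xsF /forallP xsQ]]|].
  have farx (i j : 'I_n) : i != j -> ~~ dle e H (2 * r) (xs i) (xs j).
    have lt_far (i' j' : 'I_n) : i' < j' -> ~~ dle e H (2 * r) (xs i') (xs j').
      by move: (xsF i') => /forallP/(_ j')/implyP.
    rewrite neq_ltn => /orP[/lt_far // |/lt_far]; by rewrite dle_sym.
  have xs_inj : injective xs.
    move=> i j eq_x; apply/eqP/negPn/negP => /farx; rewrite eq_x.
    by rewrite dle_refl ?xsV.
  exists [set xs i | i : 'I_n]; split.
  - by apply/subsetP => _ /imsetP[i _ ->].
  - by rewrite card_imset // card_ord.
  - move=> _ _ /imsetP[i _ ->] /imsetP[j _ ->] ne; apply: farx.
    by apply: contraNneq ne => ->.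
  - by move=> _ /imsetP[i _ ->].
move=> [S [/subsetP SV <- SF SQ]]; exists [ffun i : 'I_#|S| => enum_val i].
apply/and3P; split; apply/forallP => i.
- by rewrite ffunE SV ?enum_valP.
- apply/forallP => j; apply/implyP => lt_ij; rewrite !ffunE.
  apply: SF; rewrite ?enum_valP //; apply: contraTneq lt_ij => /enum_val_inj ->.
  by rewrite ltnn.
- by rewrite ffunE SQ ?enum_valP.
Qed.

(** Subsets of far sets are far, so a far set with more than [n] elements yields a tuple with
    exactly [n + 1]. *)
Lemma far_forallP H r n (Q : pred T) :
  reflect (forall S, S \subset ivs H -> farset H (2 * r) S ->
             {in S, forall x, Q x} -> #|S| <= n)
          (~~ [exists xs : {ffun 'I_n.+1 -> T},
             [&& inV H xs, far e H r xs & [forall i, Q (xs i)]]]).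
Proof.
apply: (iffP negP) => [nex S SV SF SQ | le_n /far_existsP[S [SV Sn SF SQ]]]; last first.
  by have := le_n S SV SF SQ; rewrite Sn ltnn.
rewrite leqNgt; apply/negP => /card_geqP[s [uniq_s size_s /subsetP sS]].
have sub : [set x in s] \subset S.
  by apply/subsetP => x; rewrite inE; apply: (subsetP sS).
apply: nex; apply/far_existsP; exists [set x in s]; split.
- exact: subset_trans SV.
- by rewrite cardsE -size_s; apply/card_uniqP.
- exact: farset_sub SF.
- by move=> x /(subsetP sub)/SQ.
Qed.

Lemma sat_basic_exP H b : bexist b ->
  reflect (exists S, [/\ S \subset ivs H, #|S| = bspread b, farset H (2 * brange b) S
                       & {in S, forall x, core_at e H (bcore b) x}])
          (sat_basic e H b).
Proof. by rewrite /sat_basic => ->; apply: far_existsP. Qed.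

Lemma sat_var_exP C M H b k : bexist b ->
  reflect (exists S, [/\ S \subset ivs H, #|S| = k, farset H (2 * brange b) S
             & {in S, forall x, (x \in ipr H C) && core_at e H (bcore b) x}])
          (sat_var e C M H b k).
Proof.
rewrite /sat_var => ->.
exact: (far_existsP H (brange b) k (fun x => (x \in ipr H C) && core_at e H (bcore b) x)).
Qed.

(** Contraposition: a universal sentence bounds the far sets of vertices violating the core, so a
    plan for it distributes a budget of violations. *)
Lemma sat_basic_unP H b : ~~ bexist b ->
  reflect (forall S, S \subset ivs H -> farset H (2 * brange b) S ->
             {in S, forall x, ~~ core_at e H (bcore b) x} -> #|S| <= bspread b)
          (sat_basic e H b).
Proof.
rewrite /sat_basic => /negPf ->; rewrite -[X in reflect _ X]negbK negb_forall.
rewrite (eq_existsb (P2 := fun xs => [&& inV H xs, far e H (brange b) xs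
   & [forall i, ~~ core_at e H (bcore b) (xs i)]])); first exact: far_forallP.
by move=> xs; rewrite negb_imply -andbA negb_exists.
Qed.

Lemma sat_var_unP C M H b k : ~~ bexist b ->
  reflect (forall S, S \subset ivs H -> farset H (2 * brange b) S ->
             {in S, forall x, (x \in ipr H M) && ~~ core_at e H (bcore b) x} -> #|S| <= k)
          (sat_var e C M H b k).
Proof.
rewrite /sat_var => /negPf ->; rewrite -[X in reflect _ X]negbK negb_forall.
rewrite (eq_existsb (P2 := fun xs => [&& inV H xs, far e H (brange b) xs
   & [forall i, (xs i \in ipr H M) && ~~ core_at e H (bcore b) (xs i)]])).
  exact: (far_forallP H (brange b) k (fun x => (x \in ipr H M) && ~~ core_at e H (bcore b) x)).
move=> xs; rewrite negb_imply negb_exists -!andbA; congr (_ && _).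
rewrite andbCA; congr (_ && _).
apply/andP/forallP => [[/forallP xM /forallP xc] i | xMc]; first by rewrite xM xc.
by split; apply/forallP => i; case/andP: (xMc i).
Qed.

End FarSets.

(** * Agreement of [G_I] with [G] inside a window *)

Lemma layer_sub (T : finType) (lam : T -> int) (a b : int) k v :
  v \in layer lam (a + k%:Z) (b - k%:Z) -> v \in layer lam a b.
Proof. by rewrite !inE; lia. Qed.

Section Window.
Variables (T : finType) (e : rel T) (G : interp T) (lam : T -> int).
Hypothesis layG : layering e G lam.
Variables (r X C M : nat).
Hypotheses (XC : X != C) (XM : X != M) (CM : C != M).
Implicit Types (a b : int) (A B : {set T}).

Local Notation GI := (GI G lam r C M).
Local Notation layer := (layer lam).

Lemma ivs_GI a b : ivs (GI a b) = ivs G :&: layer a b.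
Proof. by []. Qed.

Lemma ipr_GI_C a b A :
  ipr (setPr (GI a b) X A) C = ivs (GI a b) :&: layer (a + (2 * r)%:Z) (b - (2 * r)%:Z).
Proof. by rewrite /= eq_sym (negPf XC) (negPf CM) eqxx. Qed.

Lemma ipr_GI_M a b A :
  ipr (setPr (GI a b) X A) M = ivs (GI a b) :&: layer (a + r%:Z) (b - r%:Z).
Proof. by rewrite /= eq_sym (negPf XM) eqxx. Qed.

Lemma dle_GI a b k x y : x \in layer (a + r%:Z) (b - r%:Z) ->
  (k <= r) || (k <= 2 * r) && (y \in layer (a + r%:Z) (b - r%:Z)) ->
  dle e (GI a b) k x y = dle e G k x y.
Proof.
move=> xl yl; apply/idP/idP; first by apply: dle_sub; apply: subsetIl.
by apply: (dle_restrict layG _ xl yl); apply: subxx.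
Qed.

(** The ball of radius [k <= r] around [v] stays in the window, and the new symbols [C] and [M] do
    not occur in [psi]. *)
Lemma core_at_GI a b k psi A B v : k <= r -> rlocal k psi ->
  (forall c, c \in preds psi -> (c != C) && (c != M)) ->
  v \in ivs G -> v \in layer (a + r%:Z) (b - r%:Z) ->
  (forall y, y \in ivs (GI a b) -> (y \in A) = (y \in B)) ->
  core_at e (setPr G X A) psi v = core_at e (setPr (GI a b) X B) psi v.
Proof.
move=> le_kr loc_psi predsP vG vl eqAB.
have dleE y : dle e (setPr G X A) k v y = dle e (setPr (GI a b) X B) k v y.
  by rewrite (dle_setPr _ G) (dle_setPr _ (GI a b)) dle_GI ?le_kr.
apply: (sat_local dleE) loc_psi _ _ => // [c y cpsi|i _]; last exact: dle_refl.
rewrite dleE => /dle_in/andP[_ yV]; have /andP[/negPf cC /negPf cM] := predsP c cpsi.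
rewrite /=; case: eqP => _; first exact: eqAB.
by rewrite cC cM inE yV andbT.
Qed.

End Window.

(** * Arithmetic of covers: blocks, cores and seams *)

Section CoverArithmetic.
Variables ell r : nat.
Hypothesis ell_gt : 2 * r < ell.
Implicit Types (n j u : int).

Local Notation D := (ell - 2 * r).
Local Notation cst := (cst ell r).
Local Notation cen := (cen ell r).

(** [M_r] of interval [j] consists of the [D] layers from [n + j D + r] on; the quotient recovers
    [j]. *)
Definition cover_index n u : int := ((u - n - r%:Z) %/ D%N%:Z)%Z.

(** The seams of offset [n] are the residues [0, ..., 2 r - 1] of [u - n] modulo [D]. *)
Definition off_seams n u := ((2 * r)%:Z <= ((u - n) %% D%N%:Z)%Z)%R.

Lemma cover_indexP n j u :
  (cst n j + r%:Z <= u <= cen n j - r%:Z)%R = (cover_index n u == j).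
Proof.
rewrite /cover_index /Defs.cen /Defs.cst.
have D0 : (D%:Z != 0)%R by lia.
have D_gt0 : (0 < D%:Z)%R by lia.
have := divz_eq (u - n - r%:Z)%R D; have := ltz_pmod (u - n - r%:Z) D_gt0.
have := modz_ge0 (u - n - r%:Z) D0.
have -> : (ell%:Z - (2 * r)%:Z = D%:Z)%R by lia.
have -> : ell = D + 2 * r by lia.
rewrite addnK; move: D D0 D_gt0 => d d0 d_gt0.
move: (_ %/ _)%Z (_ %% _)%Z => q w w_ge0 w_lt eq_u.
apply/andP/eqP => [[]|<-]; last by split; nia.
move=> le_u ge_u; have := ltgtP q j; nia.
Qed.

Lemma off_seams_core n u : off_seams n u -> let j := cover_index n u in
  (cst n j + (2 * r)%:Z <= u <= cen n j - (2 * r)%:Z)%R.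
Proof.
move=> off /=.
have D_gt0 : (0 < D%:Z)%R by lia.
(* Cores are read off from the quotient without the shift by [r] in [cover_index]; both indices
   agree because a core lies inside its block. *)
pose j := ((u - n) %/ D%N%:Z)%Z.
have core_j : (cst n j + (2 * r)%:Z <= u <= cen n j - (2 * r)%:Z)%R.
  move: off; rewrite /off_seams /Defs.cen /Defs.cst.
  have := divz_eq (u - n)%R D; have := ltz_pmod (u - n) D_gt0.
  rewrite -/j (_ : ell%:Z - (2 * r)%:Z = D%:Z)%R; last by lia.
  by lia.
suff -> : cover_index n u = j by [].
by apply/eqP; rewrite -cover_indexP; lia.
Qed.

(** Core [j] ends at layer [n + j D + D - 1], and the next one begins [2 r + 1] layers later. *)
Lemma core_gap n j j' u u' : j != j' ->
  (cst n j + (2 * r)%:Z <= u <= cen n j - (2 * r)%:Z)%R ->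
  (cst n j' + (2 * r)%:Z <= u' <= cen n j' - (2 * r)%:Z)%R ->
  ((2 * r)%:Z < `|u - u'|)%R.
Proof.
rewrite /Defs.cen /Defs.cst => ne.
have -> : (ell%:Z - (2 * r)%:Z = D%:Z)%R by lia.
have -> : ell = D + 2 * r by lia.
rewrite addnK; have := ell_gt; rewrite -subn_gt0; move: D => d d_gt0.
have /orP[lt_j|lt_j] : (j < j')%R || (j' < j)%R by lia.
  have : (j * d%:Z + d%:Z <= j' * d%:Z)%R by nia.
  by lia.
have : (j' * d%:Z + d%:Z <= j * d%:Z)%R by nia.
by lia.
Qed.

End CoverArithmetic.

(** * Transfer of one basic sentence between [G] and its windows *)

Lemma card_fibers (T : finType) (I : eqType) (S : {set T}) (f : T -> I) (s : seq I) :
  uniq s -> {in S, forall v, f v \in s} ->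
  \sum_(j <- s) #|[set v in S | f v == j]| = #|S|.
Proof.
move=> uniq_s fS.
under eq_bigr => j _ do rewrite -sum1_card big_mkcond /=.
rewrite exchange_big -sum1_card [RHS]big_mkcond /=; apply: eq_bigr => v _.
under eq_bigr => j _ do rewrite inE.
case: ifP => [vS|_]; last by rewrite big1.
rewrite -big_mkcond sum1_count /=.
rewrite (eq_count (a2 := pred1 (f v))); first by rewrite count_uniq_mem // fS.
by move=> j; rewrite /= eq_sym.
Qed.

Section CoverTransfer.
Variables (T : finType) (e : rel T) (e_sym : symmetric e).
Variables (G : interp T) (lam : T -> int).
Hypothesis layG : layering e G lam.
Variables (r X C M : nat).
Hypotheses (XC : X != C) (XM : X != M) (CM : C != M).
Variables (ell : nat).
Hypothesis ell_gt : 2 * r < ell.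
Variable b : basic.
Hypotheses (b_range : brange b <= r) (b_local : rlocal (brange b) (bcore b)).
Hypothesis b_preds : forall c, c \in preds (bcore b) -> (c != C) && (c != M).
Hypothesis b_pos : xpositive X (bcore b).

Local Notation GI n j := (GI G lam r C M (cst ell r n j) (cen ell r n j)).
Local Notation zone n v := (cover_index ell r n (lam v)).

Lemma zoneP n j v :
  (v \in layer lam (cst ell r n j + r%:Z) (cen ell r n j - r%:Z)) = (zone n v == j).
Proof. by rewrite inE cover_indexP. Qed.

Definition in_core n v :=
  v \in layer lam (cst ell r n (zone n v) + (2 * r)%:Z) (cen ell r n (zone n v) - (2 * r)%:Z).

Lemma core_zone n j v :
  v \in layer lam (cst ell r n j + (2 * r)%:Z) (cen ell r n j - (2 * r)%:Z) -> zone n v = j.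
Proof. by move=> vl; apply/eqP; rewrite -zoneP; move: vl; rewrite !inE; lia. Qed.

Lemma zone_ivs n v : v \in ivs G -> v \in ivs (GI n (zone n v)).
Proof.
move=> vG; rewrite ivs_GI in_setI vG /=.
by have := eqxx (zone n v); rewrite -zoneP; apply: layer_sub.
Qed.

Lemma in_core_far n x y : in_core n x -> in_core n y -> zone n x != zone n y ->
  ~~ dle e G (2 * brange b) x y.
Proof.
move=> xc yc ne; apply/negP => /(dle_lam layG).
move: xc yc; rewrite /in_core !inE => xc yc.
by have := core_gap ell_gt ne xc yc; have := b_range; lia.
Qed.

Lemma dle_zone n j x y : zone n x = j -> zone n y = j ->
  dle e (GI n j) (2 * brange b) x y = dle e G (2 * brange b) x y.
Proof.
move=> /eqP xj /eqP yj; apply: dle_GI => //; rewrite ?zoneP //.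
by rewrite yj leq_mul2l b_range /= orbT.
Qed.

Lemma core_at_zone n A v : v \in ivs G ->
  core_at e (setPr (GI n (zone n v)) X (A :&: ivs (GI n (zone n v)))) (bcore b) v
    = core_at e (setPr G X A) (bcore b) v.
Proof.
move=> vG; apply: esym; apply: (core_at_GI layG X b_range) => //; first by rewrite zoneP.
by move=> y yV; rewrite in_setI yV andbT.
Qed.

Lemma sat_basic_of_variants n (p : int -> nat) (A : int -> {set T}) (U : {set T}) :
  is_plan (bspread b) p -> (forall j, A j \subset U) ->
  (forall j, A j \subset ivs (GI n j)) ->
  (forall j, sat_var e C M (setPr (GI n j) X (A j)) b (p j)) ->
  sat_basic e (setPr G X U) b.
Proof.
move=> [s [uniq_s p0 sum_p]] AU AV satA.
(* Positivity enlarges [A j] to the part of [U] in the window, and locality then replaces the window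
   by [G]. *)
have core_up v : v \in ivs G ->
    core_at e (setPr (GI n (zone n v)) X (A (zone n v))) (bcore b) v ->
    core_at e (setPr G X U) (bcore b) v.
  move=> vG; rewrite -(core_at_zone n) //.
  by apply: core_at_mono b_pos; rewrite subsetI AU AV.
have [ex_b|un_b] := boolP (bexist b); last first.
  apply/sat_basic_unP => // S SG SF Sc; rewrite -sum_p.
  have Sj j : #|[set v in S | zone n v == j]| <= p j.
    have /(sat_var_unP e_sym _ _ _ _ un_b) := satA j; apply.
    - apply/subsetP => v; rewrite inE => /andP[vS /eqP <-].
      exact/zone_ivs/(subsetP SG).
    - move=> x y; rewrite !inE => /andP[xS /eqP xj] /andP[yS /eqP yj] ne.
      by rewrite (dle_setPr _ (GI n j)) dle_zone //; apply: SF.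
    - move=> v; rewrite inE ipr_GI_M // => /andP[vS /eqP vj].
      have vG := subsetP SG _ vS.
      rewrite -vj in_setI zone_ivs // zoneP eqxx /=.
      exact: contra (core_up v vG) (Sc v vS).
  rewrite -(@card_fibers _ _ S (fun v => zone n v) s uniq_s); first exact: leq_sum.
  (* No vertex of [S] has its zone outside [s]: its fiber would be nonempty although [p] vanishes
     there. *)
  move=> v vS; apply: contraTT (Sj (zone n v)) => /p0 ->; rewrite -ltnNge card_gt0.
  by apply/set0Pn; exists v; rewrite inE vS /=.
apply/sat_basic_exP => //; rewrite -sum_p.
(* Witnesses are collected interval by interval; the last clause makes those of a new interval
   disjoint and far from the earlier ones. *)
suff [S [SG cardS SF Sc _]] : exists S : {set T}, [/\ S \subset ivs G,
    #|S| = \sum_(j <- s) p j, farset e G (2 * brange b) S,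
    {in S, forall v, core_at e (setPr G X U) (bcore b) v}
    & {in S, forall v, in_core n v && (zone n v \in s)}].
  by exists S; split.
elim: s uniq_s {p0 sum_p} => [_|j s IHs /= /andP[js uniq_s]].
  exists set0; rewrite cards0 big_nil sub0set; split=> // [x y|x|x]; by rewrite inE.
have [S [SG cardS SF Sc Sz]] := IHs uniq_s.
have /(sat_var_exP e_sym _ _ _ _ ex_b)[S' [S'V cardS' SF' Sc']] := satA j.
have S'j v : v \in S' -> [/\ v \in ivs G, in_core n v, zone n v = j
    & core_at e (setPr G X U) (bcore b) v].
  move=> vS; have /andP[] := Sc' v vS; rewrite ipr_GI_C // in_setI => /andP[vV vl] vc.
  have vj := core_zone vl; have vG : v \in ivs G by move: vV; rewrite ivs_GI in_setI => /andP[].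
  by split=> //; [rewrite /in_core vj | apply: core_up; rewrite ?vj].
have disj v : v \in S' -> v \in S -> false.
  by move=> /S'j[_ _ vj _] /Sz/andP[_]; rewrite vj (negPf js).
have far2 x y : x \in S' -> y \in S -> ~~ dle e G (2 * brange b) x y.
  move=> /S'j[xG xc xj _] /Sz/andP[yc ys]; apply: (in_core_far xc yc).
  by rewrite xj; apply: contraNneq js => ->.
exists (S' :|: S); split.
- by rewrite subUset SG andbT; apply/subsetP => v /S'j[].
- rewrite cardsU cardS cardS' big_cons (_ : S' :&: S = set0) ?cards0 ?subn0 //.
  by apply/setP => v; rewrite !inE; apply/negP => /andP[vS' /(disj v vS')].
- move=> x y /setUP[xS|xS] /setUP[yS|yS] ne; last exact: SF.
  + have := SF' x y xS yS ne; rewrite (dle_setPr _ (GI n j)) dle_zone //; by [case: (S'j x)|case: (S'j y)].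
  + exact: far2.
  + by rewrite dle_sym // far2.
- by move=> v /setUP[/S'j[]|/Sc].
- move=> v /setUP[/S'j[_ vc vj _]|/Sz/andP[vc vs]]; first by rewrite vc vj mem_head.
  by rewrite vc inE vs orbT.
Qed.

(** A deficit of [S] against the spread is assigned to interval [0], so that the total is exact.
    Below, a deficit occurs only for universal sentences, where a larger bound does no harm. *)
Definition fiber_plan n (S : {set T}) (j : int) : nat :=
  #|[set v in S | zone n v == j]| + (if j == 0%R then bspread b - #|S| else 0).

Lemma fiber_planP n (S : {set T}) : #|S| <= bspread b -> is_plan (bspread b) (fiber_plan n S).
Proof.
pose s := undup (0%R :: [seq zone n v | v <- enum S]).
have uniq_s : uniq s := undup_uniq _.
have s0 : 0%R \in s by rewrite mem_undup mem_head.
have zone_in v : v \in S -> zone n v \in s.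
  by move=> vS; rewrite mem_undup inE (map_f (fun v => zone n v)) ?orbT // mem_enum.
move=> le_S; exists s; split=> // [j js|].
  rewrite /fiber_plan ifN ?addn0; last by apply: contraNneq js => ->.
  apply/eqP; rewrite cards_eq0; apply/eqP/setP => v; rewrite !inE.
  by apply: contraNF js => /andP[vS /eqP <-]; apply: zone_in.
rewrite big_split card_fibers // (bigD1_seq 0%R) //= big1 ?addn0 ?subnKC //.
by move=> j /negPf ->.
Qed.

(** [S] is fixed before [n], since the offset is later chosen to keep the seams away from [S]. The
    allowance [2 r] takes care of the violating vertices near [S]. *)
Lemma variants_of_sat_basic (A : {set T}) : sat_basic e (setPr G X A) b ->
  exists S : {set T}, #|S| <= bspread b /\
    forall n, (forall v u, v \in S -> (`|u - lam v| <= (2 * r)%:Z)%R -> off_seams ell r n u) ->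
    exists p, is_plan (bspread b) p /\
      forall j, sat_var e C M (setPr (GI n j) X (A :&: ivs (GI n j))) b (p j).
Proof.
have off_in_core n v : off_seams ell r n (lam v) -> in_core n v.
  by move=> /(off_seams_core ell_gt) /= vc; rewrite /in_core inE.
have [ex_b|un_b] := boolP (bexist b).
  move=> /(sat_basic_exP e_sym _ ex_b)[S [SG cardS SF Sc]]; exists S.
  rewrite cardS leqnn; split=> // n Soff; exists (fiber_plan n S).
  have Score v : v \in S -> in_core n v.
    by move=> vS; apply/off_in_core/(Soff v) => //; rewrite subrr normr0.
  split=> [|j]; first by apply: fiber_planP; rewrite cardS.
  apply/sat_var_exP => //; exists [set v in S | zone n v == j]; split.
  - apply/subsetP => v; rewrite inE => /andP[vS /eqP <-].
    exact/zone_ivs/(subsetP SG).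
  - by rewrite /fiber_plan cardS subnn if_same addn0.
  - move=> x y; rewrite !inE => /andP[xS /eqP xj] /andP[yS /eqP yj] ne.
    by rewrite (dle_setPr _ (GI n j)) dle_zone //; apply: SF.
  - move=> v; rewrite inE ipr_GI_C // => /andP[vS /eqP <-].
    have vG := subsetP SG _ vS.
    by rewrite in_setI zone_ivs // [X in _ && X && _]Score // core_at_zone // Sc.
move=> /(sat_basic_unP e_sym _ un_b) sat_b.
pose B := [set v in ivs G | ~~ core_at e (setPr G X A) (bcore b) v].
pose farb (S : {set T}) := (S \subset B) &&
  [forall x in S, forall y in S, (x != y) ==> ~~ dle e G (2 * brange b) x y].
have farbP (S : {set T}) : reflect (S \subset B /\ farset e G (2 * brange b) S) (farb S).
  apply: (iffP andP) => -[SB SF]; split=> //.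
    by move=> x y xS yS ne; have /forall_inP/(_ x xS)/forall_inP/(_ y yS)/implyP := SF; apply.
  by apply/forall_inP => x xS; apply/forall_inP => y yS; apply/implyP; apply: SF.
have farb0 : farb set0 by apply/farbP; split=> [|x y]; rewrite ?sub0set ?inE.
(* Maximum size of [S] is used twice: to bring every violating vertex near [S], and in the exchange
   argument below. *)
case: (arg_maxnP (fun S : {set T} => #|S|) farb0) => S /farbP[SB SF] Smax.
have SG : S \subset ivs G by apply: subset_trans SB _; apply/subsetP => v; rewrite inE => /andP[].
have le_S : #|S| <= bspread b.
  by apply: sat_b => // v /(subsetP SB); rewrite inE => /andP[].
exists S; split=> // n Soff; exists (fiber_plan n S); split=> [|j]; first exact: fiber_planP.
(* A violating vertex far from all of [S] could be added to it; so each is within [2 r] of [S],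
   hence off the seams and in a core. *)
have Bcore v : v \in B -> in_core n v.
  move=> vB; apply: off_in_core; have vG : v \in ivs G by move: vB; rewrite inE => /andP[].
  have [vS|vNS] := boolP (v \in S); first by apply: (Soff v) => //; rewrite subrr normr0.
  have [/exists_inP[u uS vu]|] := boolP [exists u in S, dle e G (2 * brange b) v u].
    apply: (Soff u) => //; apply: le_trans (dle_lam layG vu) _.
    by rewrite lez_nat leq_mul2l b_range orbT.
  rewrite negb_exists_in => /forall_inP vfar.
  suff /Smax : farb (v |: S) by rewrite /= cardsU1 vNS add1n ltnn.
  apply/farbP; split=> [|x y]; first by rewrite subUset sub1set vB.
  case/setU1P=> [->|xS] /setU1P[->|yS] ne; first by rewrite eqxx in ne.
  - exact: vfar.
  - by rewrite dle_sym // vfar.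
  - exact: SF.
apply/sat_var_unP => // S' S'V SF' Sc'.
have S'j v : v \in S' -> [/\ v \in B & zone n v = j].
  move=> vS; have /andP[] := Sc' v vS; rewrite ipr_GI_M // in_setI => /andP[vV].
  rewrite zoneP => /eqP vj vc; have vG : v \in ivs G by move: vV; rewrite ivs_GI in_setI => /andP[].
  by split=> //; rewrite inE vG -(core_at_zone n) // vj.
apply: leq_trans (leq_addr _ _).
(* Exchange: replacing the part of [S] in block [j] by [S'] leaves a far set, since all its vertices
   lie in cores; it is no larger than [S]. *)
rewrite -(leq_add2r #|[set v in S | zone n v != j]|).
have -> : #|[set v in S | zone n v == j]| + #|[set v in S | zone n v != j]| = #|S|.
  rewrite -[RHS](cardsID [set v | zone n v == j]); congr (_ + _); apply: eq_card => v;
    by rewrite !inE // andbC.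
have S'S0 : S' :&: [set v in S | zone n v != j] = set0.
  by apply/setP => v; rewrite !inE; apply/negP => /and3P[/S'j[_ ->] _]; rewrite eqxx.
have <- : #|S' :|: [set v in S | zone n v != j]| = #|S'| + #|[set v in S | zone n v != j]|.
  by rewrite cardsU S'S0 cards0 subn0.
apply: Smax; apply/farbP; split=> [|x y].
  rewrite subUset; apply/andP; split; apply/subsetP => v; first by case/S'j.
  by rewrite inE => /andP[/(subsetP SB)].
have far2 u v : u \in S' -> v \in [set v in S | zone n v != j] ->
    ~~ dle e G (2 * brange b) u v.
  move=> /S'j[uB uj]; rewrite inE => /andP[/(subsetP SB) vB vj].
  by apply: (in_core_far (Bcore u uB) (Bcore v vB)); rewrite uj eq_sym.
case/setUP=> xS /setUP[] yS ne.
- have := SF' x y xS yS ne.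
  by rewrite (dle_setPr _ (GI n j)) dle_zone //; [case: (S'j x)|case: (S'j y)].
- exact: far2.
- by rewrite dle_sym // far2.
- by apply: SF => //; [move: xS|move: yS]; rewrite inE => /andP[].
Qed.

End CoverTransfer.

(** * Averaging over the offsets of a cover *)

Section OffsetChoice.
Variables (T : finType) (lam : T -> int) (ell r : nat).
Hypothesis ell_gt : 2 * r < ell.

Local Notation D := (ell - 2 * r).

Definition in_window (n j u : int) : bool := (cst ell r n j <= u <= cen ell r n j)%R.

(** Bounded layers meet only windows of bounded index, so one finite list of indices serves all
    offsets. *)
Lemma window_index_bound (n : nat) (j u : int) N : n < D -> in_window n j u ->
  (`|u| <= N)%N -> (`|j| <= N + 2 * ell)%N.
Proof.
move=> n_lt; rewrite /in_window /Defs.cen /Defs.cst.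
have -> : (ell%:Z - (2 * r)%:Z = D%:Z)%R by lia.
have D_gt0 : 0 < D by lia.
have D_le : D <= ell by lia.
move: D n_lt D_gt0 D_le => d n_lt d_gt0 d_le win u_le.
have [j0|j0] := leP 0%R j; first by nia.
have : (j * d%:Z <= j)%R by nia.
lia.
Qed.

(** The starts [n + j D] with [0 <= n < D] are distinct, so the position [g] of [u] in an interval,
    one of [ell] values, determines the interval. *)
Lemma sum_windows (s : seq int) (u : int) : uniq s ->
  \sum_(n <- iota 0 D) \sum_(j <- s) in_window n j u <= ell.
Proof.
move=> uniq_s.
pose xs := [seq (n, j) | n : nat <- iota 0 D, j : int <- s].
have <- : \sum_(x <- xs) in_window x.1%:Z x.2 u
        = \sum_(n <- iota 0 D) \sum_(j <- s) in_window n j u by rewrite big_allpairs.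
have uniq_xs : uniq xs.
  by apply: allpairs_uniq => //; [apply: iota_uniq | move=> [? ?] [? ?]].
have -> : \sum_(x <- xs) in_window x.1%:Z x.2 u
        = size [seq x <- xs | in_window x.1%:Z x.2 u].
  by rewrite size_filter -sum1_count [RHS]big_mkcond.
set ys := [seq x <- _ | _].
pose g (x : nat * int) := `|u - cst ell r x.1%:Z x.2|%N.
rewrite -(size_map g) -[X in _ <= X](size_iota 0 ell).
have ysP x : x \in ys -> x.1 < D /\ in_window x.1%:Z x.2 u.
  rewrite mem_filter => /andP[win /allpairsPdep[n [j [n_in _ def_x]]]].
  by move: n_in win; rewrite def_x mem_iota add0n.
apply: uniq_leq_size.
  rewrite map_inj_in_uniq ?filter_uniq // => -[n j] [n' j'] /ysP[/= n_lt win] /ysP[/= n'_lt win'].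
  rewrite /g /= => eq_g.
  have eq_c : cst ell r n j = cst ell r n' j'.
    by move: win win' eq_g; rewrite /in_window; lia.
  have eq_dz : (ell%:Z - (2 * r)%:Z = D%:Z)%R by lia.
  rewrite /cst eq_dz in eq_c.
  have eq_j : j = j'.
    have -> : j = ((n%:Z + j * D%:Z) %/ D%:Z)%Z.
      by rewrite addrC divzMDl ?divz_small ?addr0 //; lia.
    by rewrite eq_c addrC divzMDl ?divz_small ?addr0 //; lia.
  by subst j'; congr (_, _); lia.
move=> _ /mapP[[n j] /ysP[_ /= win] ->]; rewrite mem_iota /g /=.
by move: win; rewrite /in_window /cen; lia.
Qed.

(* The hypothesis on [f] says that the excess [f n - a] has mean at most [2 r a / d];
   at least half of the offsets are good, so some good one has at most twice that. *)
Lemma averaging (d a : nat) (f : nat -> nat) (bad : pred nat) : 0 < d ->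
  \sum_(n <- iota 0 d) f n <= (d + 2 * r) * a ->
  (forall n, n < d -> a <= f n) -> 2 * count bad (iota 0 d) <= d ->
  exists n, [/\ n < d, ~~ bad n & d * f n <= (d + 4 * r) * a].
Proof.
move=> d_gt0 sum_f f_ge bad_le.
have [/hasP[n n_in /andP[good le_f]]|/hasPn no_n] :=
  boolP (has (fun n => ~~ bad n && (d * f n <= (d + 4 * r) * a)) (iota 0 d)).
  by exists n; split=> //; rewrite mem_iota add0n in n_in.
(* If every good offset failed, its [d * f n] would exceed [d * a] by at least [4 r a + 1], the [1]
   coming from strictness. With at least [d / 2 > 0] good offsets this contradicts the bound on the
   sum. *)
have : \sum_(n <- iota 0 d) (d * a + (if ~~ bad n then 4 * r * a + 1 else 0))
     <= \sum_(n <- iota 0 d) d * f n.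
  rewrite !big_seq; apply: leq_sum => n n_in.
  have n_lt : n < d by rewrite mem_iota add0n in n_in.
  have := no_n n n_in; have := f_ge n n_lt.
  by case: (bad n) => /=; rewrite ?addn0 -?ltnNge => f_ge_a; [nia | lia].
rewrite big_split /= -big_mkcond !big_const_seq !iter_addn !addn0 -big_distrr /=.
rewrite count_predT size_iota.
have := count_predC bad (iota 0 d); rewrite size_iota.
rewrite -[count (fun n => ~~ bad n) _]/(count (predC bad) _).
move: (count (predC bad) _) (count bad _) bad_le => g B bad_le eq_d.
move: (\sum_(n <- _) _) sum_f => F sum_f le_F.
have : d * F <= d * ((d + 2 * r) * a) by rewrite leq_mul2l sum_f orbT.
have : d * (2 * r * a) <= 2 * g * (2 * r * a) by rewrite leq_mul2r; apply/orP; right; lia.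
lia.
Qed.

(* [n] is bad when some seam of the cover with offset [n] comes within [2 r] of [lam v];
   [n] is then congruent to [lam v + 2 r - c] for one of [6 r] values of [c]. *)
Definition bad_offset (Ss : seq T) (n : nat) : bool :=
  has (fun v => has (fun c : nat =>
    (n%:Z == ((lam v + (2 * r)%:Z - c%:Z)%R %% D%N%:Z)%Z)%R) (iota 0 (6 * r))) Ss.

Lemma count_bad_offsets (Ss : seq T) : count (bad_offset Ss) (iota 0 D) <= 6 * r * size Ss.
Proof.
pose l := [seq `|((lam v + (2 * r)%:Z - c%:Z)%R %% D%N%:Z)%Z|%N | v <- Ss, c : nat <- iota 0 (6 * r)].
have size_l : size l = 6 * r * size Ss by rewrite size_allpairs size_iota mulnC.
rewrite -size_filter -size_l.
apply: uniq_leq_size => [|n]; first by rewrite filter_uniq ?iota_uniq.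
rewrite mem_filter => /andP[/hasP[v vS /hasP[c c_in /eqP eq_n]] _].
by apply/allpairsP; exists (v, c); rewrite /= -eq_n.
Qed.

Lemma good_offset_off_seams (n : nat) (Ss : seq T) : n < D ->
  ~~ bad_offset Ss n ->
  forall v u, v \in Ss -> (`|u - lam v| <= (2 * r)%:Z)%R -> off_seams ell r n u.
Proof.
move=> n_lt /hasPn good v u vS u_near; rewrite /off_seams leNgt; apply/negP => w_lt.
have D0 : (D%:Z != 0)%R by lia.
have w_ge0 := modz_ge0 (u - n%:Z) D0; have eq_u := divz_eq (u - n%:Z)%R D.
move: (_ %/ _)%Z (_ %% _)%Z w_ge0 w_lt eq_u => q w w_ge0 w_lt eq_u.
(* As [w < 2 r] and [u] is within [2 r] of [lam v], the value [c = lam v + 2 r - (u - w)] lies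
   between [0] and [6 r - 1], and [u - w] is congruent to [n]. *)
have /hasPn/(_ `|(lam v + (2 * r)%:Z - (u - w))%R|%N) := good v vS.
rewrite mem_iota => /(_ ltac:(lia))/negP; apply; apply/eqP.
have -> : (lam v + (2 * r)%:Z - `|(lam v + (2 * r)%:Z - (u - w))%R|%N%:Z = q * D%:Z + n%:Z)%R by lia.
by rewrite modzMDl modz_small //; lia.
Qed.

(** The hypothesis makes at most half of the offsets bad. Over all offsets a vertex of [A] is
    counted at most [ell = D + 2 r] times, so [averaging] applies. *)
Lemma offset_choice (A : {set T}) (Ss : seq T) : 12 * r * size Ss <= D ->
  exists (n : nat) (s : seq int), [/\ uniq s,
    forall j v, j \notin s -> ~~ in_window n j (lam v),
    D * \sum_(j <- s) #|[set v in A | in_window n j (lam v)]| <= (D + 4 * r) * #|A|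
  & forall v u, v \in Ss -> (`|u - lam v| <= (2 * r)%:Z)%R -> off_seams ell r n u].
Proof.
move=> few_bad.
pose N := \max_(v : T) `|lam v|%N; pose K := N + 2 * ell.
pose s := [seq (i%:Z - K%:Z)%R | i <- iota 0 (2 * K).+1].
have uniq_s : uniq s.
  by rewrite map_inj_uniq ?iota_uniq // => i i' /eqP; rewrite (inj_eq (addIr _)) => /eqP [].
have sP (n : nat) j v : n < D -> in_window n j (lam v) -> j \in s.
  move=> n_lt win; have le_K : (`|j| <= K)%N.
    by apply: (window_index_bound n_lt win); apply: (leq_bigmax v).
  by apply/mapP; exists (`|(j + K%:Z)%R|%N); rewrite ?mem_iota; lia.
pose f (n : nat) := \sum_(j <- s) #|[set v in A | in_window n j (lam v)]|.
have fE n : f n = \sum_(v in A) \sum_(j <- s) in_window n j (lam v).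
  rewrite exchange_big; apply: eq_bigr => j _; rewrite -sum1dep_card.
  by rewrite big_mkcondr.
have [|||| n [n_lt good le_f]] := @averaging D #|A| f (bad_offset Ss).
- by rewrite subn_gt0.
- under eq_bigr => n _ do rewrite fE.
  rewrite exchange_big [X in _ <= X]mulnC -sum_nat_const; apply: leq_sum => v _.
  by rewrite subnK ?sum_windows // ltnW.
- move=> n n_lt; rewrite fE -sum1_card; apply: leq_sum => v _.
  have win : in_window n (cover_index ell r n (lam v)) (lam v).
    by have := cover_indexP ell_gt n (cover_index ell r n (lam v)) (lam v);
       rewrite eqxx /in_window; lia.
  by rewrite (bigD1_seq (cover_index ell r n (lam v))) ?(sP n _ v) //= win leq_addr.
- by have := count_bad_offsets Ss; lia.
exists n, s; split=> // [j v|]; first by apply: contra; apply: sP.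
exact: good_offset_off_seams.
Qed.

End OffsetChoice.

(** * The minimum [gamma] *)

Section Gamma.
Variables (T : finType) (X : nat) (H : interp T) (P : interp T -> bool).

Lemma gamma_le (A : {set T}) : A \subset ivs H -> P (setPr H X A) -> gamma X H P <= #|A|.
Proof.
move=> AH PA; rewrite /gamma; have := mem_index_enum A.
elim: (index_enum _) => // B l IHl; rewrite inE big_cons.
case/orP=> [/eqP<-|/IHl le_A]; first by rewrite AH PA geq_minl.
by case: ifP => // _; rewrite geq_min le_A orbT.
Qed.

(** The feasible [A0] starts the minimisation; the default [#|T|] in [gamma] is harmless, being at
    least every cardinality. *)
Lemma gamma_attained (A0 : {set T}) : A0 \subset ivs H -> P (setPr H X A0) ->
  exists A : {set T}, [/\ A \subset ivs H, P (setPr H X A) & #|A| <= gamma X H P].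
Proof.
move=> A0H PA0.
pose Q (A : {set T}) := (A \subset ivs H) && P (setPr H X A).
have QA0 : Q A0 by rewrite /Q A0H.
case: (arg_minnP (fun A : {set T} => #|A|) QA0) => A /andP[AH PA] Amin.
exists A; split=> //; rewrite /gamma; apply: (big_ind (fun x => #|A| <= x)) => [|x y le_x le_y|B QB].
- exact: max_card.
- by rewrite leq_min le_x.
- exact: Amin.
Qed.

End Gamma.

(** * Monotonicity of variants and passage to conjunctions *)

Lemma sat_var_mono (T : finType) (e : rel T) (X C M : nat) (H : interp T) (b : basic) k
    (A B : {set T}) : symmetric e -> X != C -> X != M -> xpositive X (bcore b) ->
  A \subset B -> sat_var e C M (setPr H X A) b k -> sat_var e C M (setPr H X B) b k.
Proof.
move=> e_sym XC XM b_pos AB; have [ex_b|un_b] := boolP (bexist b).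
  move=> /(sat_var_exP e_sym _ _ _ _ ex_b)[S [SV cardS SF Sc]].
  apply/(sat_var_exP e_sym _ _ _ _ ex_b); exists S; split=> // v /Sc.
  rewrite /= ![C == X]eq_sym (negPf XC) => /andP[-> /=].
  exact: core_at_mono.
move=> /(sat_var_unP e_sym _ _ _ _ un_b) sat_A.
apply/(sat_var_unP e_sym _ _ _ _ un_b) => S SV SF Sc; apply: sat_A => // v /Sc.
rewrite /= ![M == X]eq_sym (negPf XM) => /andP[-> /=].
by apply: contra; apply: core_at_mono.
Qed.

Lemma sat_varc_pI (T : finType) (e : rel T) C M (H : interp T) phi (p : nat -> int -> nat) j b0 :
  reflect (forall i, i < size phi -> sat_var e C M H (nth b0 phi i) (p i j))
          (sat_varc e C M H phi (pI (size phi) p j)).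
Proof.
have size_pI : size (pI (size phi) p j) = size phi by rewrite size_map size_iota.
have nth_pI i : i < size phi ->
    nth (b0, 0) (zip phi (pI (size phi) p j)) i = (nth b0 phi i, p i j).
  by move=> lt_i; rewrite nth_zip // (nth_map 0) ?size_iota // nth_iota.
apply: (iffP (all_nthP (b0, 0))); rewrite size_zip size_pI minnn => satp i lt_i.
  by have := satp i lt_i; rewrite nth_pI.
by rewrite nth_pI //; apply: satp.
Qed.

Lemma card_bigcup_seq (T : finType) (I : Type) (s : seq I) (F : I -> {set T}) :
  #|\bigcup_(j <- s) F j| <= \sum_(j <- s) #|F j|.
Proof.
elim: s => [|j s IHs]; first by rewrite !big_nil cards0.
by rewrite !big_cons (leq_trans (leq_card_setU _ _)) ?leq_add2l.
Qed.

Section Conjunction.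
Variables (T : finType) (e : rel T) (e_sym : symmetric e).
Variables (G : interp T) (lam : T -> int).
Hypothesis layG : layering e G lam.
Variables (r X C M : nat).
Hypotheses (XC : X != C) (XM : X != M) (CM : C != M).
Variables (ell : nat).
Hypothesis ell_gt : 2 * r < ell.

Definition admissible (b : basic) :=
  [/\ brange b <= r, rlocal (brange b) (bcore b), xpositive X (bcore b)
    & forall c, c \in preds (bcore b) -> (c != C) && (c != M)].

Local Notation GI n j := (GI G lam r C M (cst ell r n j) (cen ell r n j)).

(** Concatenating the sets found for the conjuncts gives a single condition on the offset that suits
    all of them. *)
Lemma variants_of_sat_conj (A : {set T}) (phi : seq basic) b0 :
  (forall i, i < size phi -> admissible (nth b0 phi i)) -> sat_conj e (setPr G X A) phi ->
  exists Ss : seq T, size Ss <= \sum_(b <- phi) bspread b /\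
    forall n, (forall v u, v \in Ss -> (`|u - lam v| <= (2 * r)%:Z)%R -> off_seams ell r n u) ->
    exists p : nat -> int -> nat, forall i, i < size phi ->
      is_plan (bspread (nth b0 phi i)) (p i) /\
      forall j, sat_var e C M (setPr (GI n j) X (A :&: ivs (GI n j))) (nth b0 phi i) (p i j).
Proof.
elim: phi => [|b phi IHphi] adm /= => [_|/andP[sat_b sat_phi]].
  by exists [::]; rewrite big_nil; split=> // n _; exists (fun _ _ => 0).
have [Ss [size_Ss Ss_plan]] := IHphi (fun i lt_i => adm i.+1 lt_i) sat_phi.
have [b_range b_local b_pos b_preds] := adm 0 isT.
have [S [card_S S_plan]] :=
  variants_of_sat_basic e_sym layG XC XM CM ell_gt b_range b_local b_preds b_pos sat_b.
exists (enum S ++ Ss); rewrite size_cat -cardE big_cons leq_add //; split=> // n off.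
have [|p0 [plan0 sat0]] := S_plan n.
  by move=> v u vS; apply: off; rewrite mem_cat mem_enum vS.
have [|p p_ok] := Ss_plan n.
  by move=> v u vS; apply: off; rewrite mem_cat vS orbT.
by exists (fun i => if i is i'.+1 then p i' else p0) => -[_|i lt_i]; [split | apply: p_ok].
Qed.

End Conjunction.

(** * Assembly of the approximation bound *)

Theorem mainTheorem15 (R : realFieldType) (T : finType) (e : rel T)
  (e_sym : symmetric e) (e_irr : irreflexive e)
  (L : seq nat) (X C M : nat) (phi : seq basic) (m r : nat)
  (phi_lang : all (fun b => all (fun c => c \in X :: L) (preds (bcore b))) phi)
  (phi_local : all (fun b => rlocal (brange b) (bcore b)) phi)
  (phi_pos : all (fun b => xpositive X (bcore b)) phi)
  (Hm : m = \max_(b <- phi) bspread b) (Hr : r = \max_(b <- phi) brange b)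
  (HC : C \notin X :: L) (HM : M \notin X :: L) (HCM : C != M)
  (eps1 eps2 : R) (Heps1 : (0 < eps1)%R) (Heps2 : (0 < eps2)%R)
  (G : interp T) (lam : T -> int) (Hlam : layering e G lam)
  (Asel : int -> int -> seq nat -> option {set T})
  (HAsel : forall (a b : int) (q : seq nat), (a <= b)%R -> size q = size phi ->
             Aspec e G lam r X C M phi eps1 a b q (Asel a b q))
  (ell : nat)
  (Hell : ((2 * r)%:R * (1 + Num.max (2 / eps2) (6 * m * size phi)%:R) < ell%:R :> R)%R) :
  (~~ sat_conj e (setPr G X (ivs G)) phi /\ ~ (exists n p, valid Asel ell r phi n p))
  \/
  ((exists n p, valid Asel ell r phi n p) /\
   forall (n : int) (p : nat -> int -> nat) (a : nat) (U : {set T}),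
     valid Asel ell r phi n p -> asum Asel ell r phi n p a -> Aunion Asel ell r phi n p U ->
     (forall n' p' a', valid Asel ell r phi n' p' -> asum Asel ell r phi n' p' a' -> a <= a') ->
     sat_conj e (setPr G X U) phi /\
     (#|U|%:R <= (1 + eps1) * (1 + eps2) * (gamma X G (fun H => sat_conj e H phi))%:R :> R)%R).
Proof.
have XC : X != C by apply: contraNneq HC => ->; rewrite mem_head.
have XM : X != M by apply: contraNneq HM => ->; rewrite mem_head.
pose b0 := Basic true 0 0 FTrue.
(* Both terms of the maximum are used: the second makes half of the offsets good, the first bounds
   the relative overlap [4 r / D] by [eps2]. *)
have le_ell x : (x <= Num.max (2 / eps2) (6 * m * size phi)%:R)%R ->
    ((2 * r)%:R * (1 + x) < ell%:R :> R)%R.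
  move=> le_x; apply: le_lt_trans Hell; apply: ler_wpM2l; rewrite ?ler0n //.
  by rewrite lerD2l.
have ell_gt6 : 2 * r * (1 + 6 * m * size phi) < ell.
  rewrite -(ltr_nat R) natrM natrD; apply: le_ell.
  by rewrite le_max lexx orbT.
have ell_gt2 : ((4 * r)%:R <= eps2 * (ell - 2 * r)%:R :> R)%R.
  have := le_ell (2 / eps2)%R; rewrite le_max lexx => /(_ isT).
  rewrite natrB; last by lia.
  rewrite -(ltr_pM2l Heps2) mulrCA mulrDr mulr1 mulrCA divff ?lt0r_neq0 //.
  rewrite !natrM; lra.
have ell_gt : 2 * r < ell by lia.
pose D := ell - 2 * r.
have D_gt0 : 0 < D by rewrite /D subn_gt0.
have adm i : i < size phi -> admissible r X C M (nth b0 phi i).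
  move=> lt_i; split.
  - by rewrite Hr (big_nth b0) big_mkord; apply: (leq_bigmax (Ordinal lt_i)).
  - exact: (all_nthP b0 phi_local).
  - exact: (all_nthP b0 phi_pos).
  - move=> c c_in; have /allP/(_ c c_in) c_lang := all_nthP b0 phi_lang i lt_i.
    by apply/andP; split; [apply: contraNneq HC|apply: contraNneq HM] => <-.
have cst_le n j : (cst ell r n j <= cen ell r n j)%R by rewrite /cen; lia.
have AIP n p j : AIj Asel ell r phi n p j <> None ->
    exists A, [/\ AIj Asel ell r phi n p j = Some A,
      A \subset ivs (GI G lam r C M (cst ell r n j) (cen ell r n j)),
      sat_varc e C M (setPr (GI G lam r C M (cst ell r n j) (cen ell r n j)) X A) phi
        (pI (size phi) p j)
    & (#|A|%:R <= (1 + eps1) * (gamma X (GI G lam r C M (cst ell r n j) (cen ell r n j))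
        (fun H' => sat_varc e C M H' phi (pI (size phi) p j)))%:R)%R].
  have := HAsel _ _ (pI (size phi) p j) (cst_le n j).
  by rewrite /Aspec size_map size_iota => /(_ erefl); case: ifP.
(* Any [U] containing the selected sets is allowed, as this serves twice: with all of [V(G)] to
   refute plans, and with the union of the sets. *)
have sound n p (U : {set T}) : valid Asel ell r phi n p ->
    (forall j A, AIj Asel ell r phi n p j = Some A -> A \subset U) ->
    sat_conj e (setPr G X U) phi.
  move=> [plans defd] subU; apply/(all_nthP b0) => i lt_i.
  have [b_range b_local b_pos b_preds] := adm i lt_i.
  apply: (sat_basic_of_variants e_sym Hlam XC XM HCM ell_gt b_range b_local b_preds b_pos
    (n := n) (A := fun j => odflt set0 (AIj Asel ell r phi n p j)) (plans i lt_i)) => j;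
    have [A [defA AV satA _]] := AIP n p j (defd j); rewrite defA //=; first exact: subU defA.
  by move/(sat_varc_pI _ _ _ _ _ _ _ b0): satA; apply.
have [satV|unsatV] := boolP (sat_conj e (setPr G X (ivs G)) phi); last first.
  left; split=> // -[n [p val_np]]; move/negP: unsatV; apply; apply: sound val_np _.
  move=> j A defA; have [|A' [defA' AV _ _]] := AIP n p j; first by rewrite defA.
  move: defA'; rewrite defA => -[eqA]; subst A'.
  exact: subset_trans AV (subsetIl _ _).
right.
have [A [AG satA le_gamma]] := gamma_attained
  (P := fun H => sat_conj e H phi) (subxx (ivs G)) satV.
have [Ss [size_Ss Ss_plan]] :=
  variants_of_sat_conj e_sym Hlam XC XM HCM ell_gt adm satA.
have le_m : \sum_(b <- phi) bspread b <= m * size phi.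
  rewrite (big_nth b0) big_mkord mulnC -[X in X * _]card_ord -sum_nat_const.
  apply: leq_sum => i _; rewrite Hm (big_nth b0) big_mkord.
  exact: (leq_bigmax i).
have [|n [s [uniq_s s_win le_s n_off]]] := @offset_choice T lam ell r ell_gt A Ss.
  have : 6 * r * size Ss <= 6 * r * (m * size phi).
    by rewrite leq_mul2l (leq_trans size_Ss le_m) orbT.
  by move: ell_gt6; clear; lia.
have [p p_ok] := Ss_plan n n_off.
have satc j : sat_varc e C M (setPr (GI G lam r C M (cst ell r n j) (cen ell r n j)) X
    (A :&: ivs (GI G lam r C M (cst ell r n j) (cen ell r n j)))) phi (pI (size phi) p j).
  by apply/(sat_varc_pI _ _ _ _ _ _ _ b0) => i /p_ok[].
have val_np : valid Asel ell r phi n p.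
  split=> [i /p_ok[] // | j defA].
  have := HAsel _ _ (pI (size phi) p j) (cst_le n j).
  rewrite /Aspec size_map size_iota => /(_ erefl).
  (* [A] restricted to a window realises the variant there; by positivity so does the whole window,
     hence the selected set is defined. *)
  rewrite ifT; last first.
    apply/(sat_varc_pI _ _ _ _ _ _ _ b0) => i lt_i; have [_ _ b_pos _] := adm i lt_i.
    by apply: sat_var_mono ((p_ok i lt_i).2 j) => //; apply: subsetIr.
  by case=> A' [defA' _ _ _]; move: defA; rewrite /AIj defA'.
split; first by exists (n%:Z)%R, p.
move=> n1 p1 a1 U val1 [s1 [uniq_s1 s1_supp def_a1]] defU min_a1.
split.
  apply: sound val1 _ => j A' defA'; apply/subsetP => v vA.
  by apply/defU; exists j, A'.
have le_U : #|U| <= a1.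
  rewrite def_a1; apply: leq_trans (card_bigcup_seq _ _); apply: subset_leq_card.
  apply/subsetP => v /defU[j [A' [defA' vA']]].
  have js : j \in s1.
    by apply: contraTT vA' => /s1_supp/(_ _ defA') ->; rewrite inE.
  by rewrite (bigD1_seq j) //= inE defA' vA'.
pose a := \sum_(j <- s) #|odflt set0 (AIj Asel ell r phi n p j)|.
have le_a1 : a1 <= a.
  (* Windows outside [s] contain no vertex, so [s] carries the whole sum of the comparison plan. *)
  apply: (min_a1 n p) => //; exists s; split=> // j js A' defA'.
  have [|A'' [defA'' AV _ _]] := AIP n p j; first by rewrite defA'.
  move: defA''; rewrite defA' => -[eqA]; subst A''.
  apply/eqP; rewrite -subset0; apply: subset_trans AV _; apply/subsetP => v.
  rewrite ivs_GI in_setI => /andP[_]; rewrite inE => vw.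
  by have := s_win j v js; rewrite /in_window vw.
(* In each window the restriction of [A] is feasible for the variant and so bounds its [gamma]. *)
have le_a : (a%:R <= (1 + eps1) *
    (\sum_(j <- s) #|[set v in A | in_window ell r n j (lam v)]|)%:R :> R)%R.
  rewrite !natr_sum mulr_sumr; apply: ler_sum => j _.
  have [A' [-> _ _ le_A']] := AIP n p j (val_np.2 j).
  apply: le_trans le_A' _; apply: ler_wpM2l; first by lra.
  rewrite ler_nat; apply: leq_trans (gamma_le (subsetIr _ _) (satc j)) _.
  apply: subset_leq_card; apply/subsetP => v; rewrite in_setI ivs_GI in_setI inE.
  by move=> /and3P[-> _]; rewrite inE.
set F := \sum_(j <- s) _ in le_s le_a.
(* Combines [D F <= (D + 4 r) |A|] with [4 r <= eps2 D]. *)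
have le_F : (F%:R <= (1 + eps2) * #|A|%:R :> R)%R.
  have D_gt0R : (0 < D%:R :> R)%R by rewrite ltr0n.
  rewrite -(ler_pM2l D_gt0R).
  have : (D%:R * F%:R <= (D%:R + (4 * r)%:R) * #|A|%:R :> R)%R.
    by rewrite -natrD -!natrM ler_nat.
  move/le_trans; apply; rewrite mulrA; apply: ler_wpM2r; first exact: ler0n.
  by move: ell_gt2; rewrite -/D; lra.
have gamma_ge : (#|A|%:R <= (gamma X G (fun H => sat_conj e H phi))%:R :> R)%R.
  by rewrite ler_nat.
apply: (@le_trans _ _ a%:R%R); first by rewrite ler_nat (leq_trans le_U).
apply: le_trans le_a _; rewrite -mulrA; apply: ler_wpM2l; first by lra.
apply: le_trans le_F _; apply: ler_wpM2l => //; lra.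
Qed.
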